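(* Let $p(s)=p_0+p_1s+\cdots+p_ns^n\in\mathbb{R}[s]$ be a polynomial of degree $n$, let $\mathcal{P}\subset\mathbb{C}$ be the connected component including the origin and delimited by the frequency response $\partial\mathcal{P}=\{p(j\omega) : \omega\in\mathbb{R}\}$, and let $F(x,y)$ be the symmetric $n\times n$ pencil $$F(x,y)=\pm\bigl(B(q_x,q_y)+x\,B(q_y,q_z)-y\,B(q_x,q_z)\bigr)$$ associated with $p$ (with a suitable choice of the overall sign $\pm$). Then $\mathcal{P}$ can be described by the linear matrix inequality $$\mathcal{P}=\{x+jy : x,y\in\mathbb{R},\ F(x,y)\succeq 0\}$$ if and only if $p$ is stable.
   Context: Here $j$ is the imaginary unit. A polynomial $p\in\mathbb{R}[s]$ is called stable if all its roots lie in the open left half-plane. The polynomials $q_x,q_y,q_z\in\mathbb{R}[\omega]$ are $q_x(\omega)=\mathrm{Re}\,p(j\omega)=p_0-p_2\omega^2+p_4\omega^4-\cdots$, $q_y(\omega)=\mathrm{Im}\,p(j\omega)=p_1\omega-p_3\omega^3+p_5\omega^5-\cdots$, and $q_z(\omega)=1$. The frequency response is the curve $\partial\mathcal{P}=\{p(j\omega):\omega\in\mathbb{R}\}=\{q_x(\omega)+jq_y(\omega):\omega\in\mathbb{R}\}$. It partitions the complex plane into several connected components; $\mathcal{P}$ denotes the one containing the origin, taken as a closed region, i.e. the closure of the connected component of $\mathbb{C}\setminus\partial\mathcal{P}$ that contains $0$. Bézoutian: for two real univariate polynomials $g(\omega)=\sum_{i=0}^n g_i\omega^i$ and $h(\omega)=\sum_{i=0}^n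 h_i\omega^i$, both regarded as polynomials of degree $n=\deg p$ (padding with zero coefficients if necessary), $B(g,h)$ is the symmetric $n\times n$ matrix with entries $b_{kl}$, $0\le k,l\le n-1$, defined by $$\frac{g(\omega)h(v)-g(v)h(\omega)}{\omega-v}=\sum_{k=0}^{n-1}\sum_{l=0}^{n-1}b_{kl}\,\omega^kv^l.$$ $\succeq 0$ means positive semidefinite. *)

(* Defs.v *)
From mathcomp Require Import all_boot all_order all_algebra.
From mathcomp Require Import all_classical all_reals all_analysis.
From mathcomp Require Import complex ring.

Set Implicit Arguments.
Unset Strict Implicit.
Unset Printing Implicit Defensive.

Import Order.TTheory GRing.Theory Num.Theory.
Import numFieldNormedType.Exports.

Local Open Scope classical_set_scope.
Local Open Scope ring_scope.
Local Open Scope complex_scope.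

Definition ceval (R : realType) (p : {poly R}) (z : R[i]) : R[i] :=
  (map_poly (real_complex R) p).[z].

Definition stable (R : realType) (p : {poly R}) : Prop :=
  forall z : R[i], ceval p z = 0 -> complex.Re z < 0.

(* Coefficients of Re p(jw) and Im p(jw) as polynomials in w; see
   [ceval_imag]. *)
Definition qx (R : realType) (p : {poly R}) : {poly R} :=
  \poly_(i < size p) (if odd i then 0 else (-1) ^+ i./2 * p`_i).

Definition qy (R : realType) (p : {poly R}) : {poly R} :=
  \poly_(i < size p) (if odd i then (-1) ^+ i./2 * p`_i else 0).

Definition qz (R : realType) : {poly R} := 1.

Lemma ceval_imag (R : realType) (p : {poly R}) (w : R) :
  ceval p (0 +i* w) = (qx p).[w] +i* (qy p).[w].
Proof.
have imX i : (0 +i* w) ^+ i =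
    if odd i then 0 +i* ((-1) ^+ i./2 * w ^+ i)
    else ((-1) ^+ i./2 * w ^+ i) +i* 0 :> R[i].
  elim: i => [|i IH]; first by rewrite !expr0 mulr1.
  rewrite exprS IH /= uphalf_half exprD exprS; case: (odd i) => /=;
    apply/eqP; rewrite eq_complex /=; apply/andP; split; apply/eqP; ring.
rewrite /ceval (@horner_coef_wide _ (size p)); last exact: size_poly.
rewrite !horner_poly.
elim/big_rec3: _ => [//|i x y z _ ->]; rewrite coef_map /= imX.
case: (odd i); apply/eqP; rewrite eq_complex /=; apply/andP;
  split; apply/eqP; ring.
Qed.

(* In {poly {poly R}} the outer indeterminate 'X stands for w and the inner
   one, 'X%:P, for v: g^:P is g(w) and g%:P is g(v).  The divisor is monic in
   w and the division is exact; see [bezoutianP]. *)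
Definition bezoutian (R : realType) (n : nat) (g h : {poly R}) : 'M[R]_n :=
  \matrix_(k, l)
    (((g^:P * h%:P - g%:P * h^:P) %/ ('X - 'X%:P) : {poly {poly R}})`_k)`_l.

Lemma bezoutianP (R : realType) (n : nat) (g h : {poly R}) (w v : R) :
    (size g <= n.+1)%N -> (size h <= n.+1)%N ->
  (w - v) * (\sum_k \sum_l bezoutian n g h k l * w ^+ k * v ^+ l) =
  g.[w] * h.[v] - g.[v] * h.[w].
Proof.
move=> sg sh; pose D : {poly {poly R}} := 'X - 'X%:P.
pose N : {poly {poly R}} := g^:P * h%:P - g%:P * h^:P.
pose Q : {poly {poly R}} := N %/ D.
have mD : D \is monic by exact: monicXsubC.
have DN : Q * D = N.
  apply: Pdiv.IdomainUnit.divpK; first by rewrite (monicP mD) unitr1.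
  rewrite dvdp_XsubCl rootE /N hornerD hornerN !hornerM !hornerC.
  by rewrite -/(comp_poly 'X g) -/(comp_poly 'X h) !comp_polyXr subrr.
have szM (p q : {poly R}) :
    (size p <= n.+1)%N -> (size (p^:P * q%:P)%R <= n.+1)%N.
  move=> sp; rewrite mulrC mul_polyC (leq_trans (size_scale_leq _ _)) //.
  by rewrite size_map_polyC.
have szQ (T M : {poly {poly R}}) :
    T * D = M -> (size M <= n.+1)%N -> (size T <= n)%N.
  by move=> <-; have [->|T0] := eqVneq T 0; rewrite ?size_poly0 //
    size_Mmonic // size_XsubC addn2.
have sQ : (size Q <= n)%N.
  apply: (szQ _ _ DN); rewrite (leq_trans (size_polyD _ _)) // geq_max.
  by rewrite size_polyN [g%:P * _]mulrC !szM.
have sQ' : (size (swapXY Q) <= n)%N.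
  have := congr1 swapXY DN; rewrite !(rmorphM, rmorphB) /=.
  rewrite !swapXY_polyC !swapXY_map_polyC swapXY_X map_polyX -opprB mulrN.
  move=> /eqP; rewrite eqr_oppLR => /eqP /szQ; apply.
  rewrite size_polyN (leq_trans (size_polyD _ _)) // geq_max.
  by rewrite size_polyN ![_%:P * _]mulrC !szM.
have sQk k : (size (Q`_k)%R <= n)%N.
  apply/leq_sizeP => l ln; rewrite -coef_swapXY.
  by rewrite (nth_default _ (leq_trans sQ' ln)) coef0.
have -> : \sum_k \sum_l bezoutian n g h k l * w ^+ k * v ^+ l =
    Q.[w%:P].[v].
  rewrite (horner_coef_wide _ sQ) horner_sum; apply: eq_bigr => k _.
  rewrite hornerM -rmorphXn /= hornerC (horner_coef_wide _ (sQk k)) mulr_suml.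
  by apply: eq_bigr => l _; rewrite mxE mulrAC.
have evP (p : {poly R}) : p^:P.[w%:P].[v] = p.[w] by rewrite horner_map hornerC.
have := congr1 (fun T : {poly {poly R}} => T.[w%:P].[v]) DN.
by rewrite /D /N !(hornerE, evP) mulrC.
Qed.

Definition pencil (R : realType) (n : nat) (p : {poly R}) (x y : R) : 'M[R]_n :=
  bezoutian n (qx p) (qy p) + x *: bezoutian n (qy p) (qz R)
  - y *: bezoutian n (qx p) (qz R).

Definition psd (R : realType) (n : nat) (A : 'M[R]_n) : Prop :=
  A^T = A /\ forall v : 'cV[R]_n, 0 <= (v^T *m A *m v) 0 0.

(* R[i]^o is the complex plane with the topology of its norm. *)
Definition frequency_response (R : realType) (p : {poly R}) : set R[i]^o :=
  [set ceval p (0 +i* w) | w in [set: R]].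

(* Empty when 0 lies on the frequency response. *)
Definition origin_region (R : realType) (p : {poly R}) : set R[i]^o :=
  closure (connected_component (~` frequency_response p) 0).

(* Main.v *)
Require Import Defs.
From mathcomp Require Import all_boot all_order all_algebra.
From mathcomp Require Import all_classical all_reals all_analysis.
From mathcomp Require Import complex ring lra zify.

Import Order.TTheory GRing.Theory Num.Theory.
Import numFieldNormedType.Exports.

Local Open Scope classical_set_scope.
Local Open Scope ring_scope.
Local Open Scope complex_scope.

(** The pencil is affine in [z = x + jy] and, up to the sign [-1], it is the
    Bezoutian of [qx - x] and [qy - y], the real and imaginary parts of
    [w |-> p(jw) - z].  With [H(z)] for this matrix and
    [f(w) = p(jw) - z], Hermite's identity reads
      [(s - t) * sum_kl H(z)_kl s^k t^l = Im (f(s) * conj f(t))],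
    and the whole proof compares the definiteness of [H(z)] with the location
    of the roots of [p - z].

    - Adding to [p - z] a root [r] changes the right-hand side in a way which
      preserves sums of squares as long as [Re r <= 0]
      ([left_roots_squares]); hence [H(z)] is positive semidefinite when all
      roots of [p - z] lie in the closed left half-plane ([hermite_psd]).
    - Semidefiniteness on a whole disc around [z] gives definiteness at [z]
      ([psd_ball_posdef]): a vector killed by [H(z)] would be killed by all
      values of the affine map [H], while its coefficient of [x] or of [y] is
      a triangular Hankel matrix with [+- p_n] on the antidiagonal.
    - If [H(z)] is definite then [z] is off the curve ([posdef_off_curve]), and
      evaluating the identity at a complex root and its conjugate shows that
      no root of [p - z] is in the open right half-plane ([posdef_roots]).

    Let [S] be the set of the [z] for which [p - z] has all its roots in the
    open left half-plane.  No continuity of roots is needed to see that [S] is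
    open, and closed in the complement of the curve: factoring [p - z] bounds
    [|p(s) - z|] from below for [Re s >= 0], by the product of the distances
    from [s] to the roots.  So if [p] is stable, i.e. [0] is in [S], the
    component of [0] lies in [S], where [H] is semidefinite, and so does its
    closure in the closed set where [H] is semidefinite.  Conversely, if [H(z)]
    is semidefinite then [H] is definite on the segment from [0] to [z] except
    perhaps at [z] itself, so this half-open segment avoids the curve and [z]
    is in the closure of the component.

    If conversely the closure of the component is the set where [H] is
    semidefinite, and [0] is off the curve, then a disc around [0] is in this
    set, so that [H(0)] is definite and [p] has no root in the open right
    half-plane; there is none on the imaginary axis since [0] is off the
    curve.

    The case [n = 0] is apart: the curve is a point, the matrices are empty,
    and the region is the whole plane. *)

(** * Bilinear forms on vectors of powers *)

(** The points used are natural numbers, so that an identity known on the real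
    line is enough for a polynomial with complex coefficients. *)
Lemma poly_nat_eq0 (F : numDomainType) (P : {poly F}) :
  (forall m : nat, P.[m%:R] = 0) -> P = 0.
Proof.
move=> P0; apply: (@roots_geq_poly_eq0 _ _ [seq m%:R | m <- iota 0 (size P)]).
- by apply/allP => _ /mapP[m _ ->]; rewrite rootE P0.
- by rewrite map_inj_uniq ?iota_uniq //; exact: mulrIn (oner_neq0 _).
- by rewrite size_map size_iota.
Qed.

Lemma poly_eq0_off (F : numDomainType) (P : {poly F}) (v : F) :
  (forall w, (w - v) * P.[w] = 0) -> P = 0.
Proof.
move=> P0; have /eqP : ('X - v%:P) * P = 0.
  by apply: poly_nat_eq0 => m; rewrite hornerM hornerXsubC P0.
by rewrite mulf_eq0 polyXsubC_eq0 => /eqP.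
Qed.

Definition bil {F : comNzRingType} {n} (M : 'M[F]_n) (u v : 'cV[F]_n) : F :=
  (u^T *m M *m v) 0 0.

Definition powers {F : comNzRingType} n (w : F) : 'cV[F]_n := \col_k w ^+ k.

Section Bil.
Variables (F : comNzRingType) (n : nat).
Implicit Types (M N : 'M[F]_n) (u v : 'cV[F]_n).

Lemma bilE M u v : bil M u v = \sum_k \sum_l M k l * u k 0 * v l 0.
Proof.
rewrite /bil mxE exchange_big; apply: eq_bigr => l _ /=.
rewrite mxE mulr_suml; apply: eq_bigr => k _.
by rewrite mxE [u k 0 * _]mulrC.
Qed.

Lemma bil_powers M (s t : F) :
  bil M (powers n s) (powers n t) = \sum_k \sum_l M k l * s ^+ k * t ^+ l.
Proof. by rewrite bilE; do 2!apply: eq_bigr => ? _; rewrite !mxE. Qed.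

Lemma bilD M N u v : bil (M + N) u v = bil M u v + bil N u v.
Proof. by rewrite /bil mulmxDr mulmxDl mxE. Qed.

Lemma bilZ a M u v : bil (a *: M) u v = a * bil M u v.
Proof. by rewrite /bil -scalemxAr -scalemxAl mxE. Qed.

Lemma bilN M u v : bil (- M) u v = - bil M u v.
Proof. by rewrite -scaleN1r bilZ mulN1r. Qed.

Lemma bilDl M u u' v : bil M (u + u') v = bil M u v + bil M u' v.
Proof. by rewrite /bil linearD /= !mulmxDl mxE. Qed.

Lemma bilDr M u v v' : bil M u (v + v') = bil M u v + bil M u v'.
Proof. by rewrite /bil mulmxDr mxE. Qed.

Lemma bilZl M a u v : bil M (a *: u) v = a * bil M u v.
Proof. by rewrite /bil linearZ /= -!scalemxAl mxE. Qed.

Lemma bilZr M a u v : bil M u (a *: v) = a * bil M u v.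
Proof. by rewrite /bil -scalemxAr mxE. Qed.

Lemma bil_tr M u v : bil M^T u v = bil M v u.
Proof.
rewrite !bilE exchange_big; do 2!apply: eq_bigr => ? _.
by rewrite mxE mulrAC.
Qed.

Lemma powersE (u : 'cV[F]_n) w :
  ((powers n w)^T *m u) 0 0 = (\sum_k u k 0 *: 'X^k).[w].
Proof.
rewrite mxE horner_sum; apply: eq_bigr => k _.
by rewrite !mxE hornerZ hornerXn mulrC.
Qed.
End Bil.

Lemma powers_eq0 (F : numDomainType) n (u : 'cV[F]_n) v :
  (forall w, (w - v) * ((powers n w)^T *m u) 0 0 = 0) -> u = 0.
Proof.
move=> u0; have/polyP U0 : \sum_k u k 0 *: 'X^k = 0.
  by apply: (@poly_eq0_off _ _ v) => w; rewrite -powersE u0.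
apply/colP => k; have := U0 k; rewrite !mxE coef0 coef_sum.
rewrite (bigD1 k) //= coefZ coefXn eqxx mulr1 big1 ?addr0 // => i ik.
by rewrite coefZ coefXn (inj_eq val_inj) eq_sym (negPf ik) mulr0.
Qed.

(** The generating function [sum_kl M_kl w^k v^l] determines [M]; the factor
    [w - v] is allowed because Bezoutians are defined by their product with
    it. *)
Lemma bil_powers_eq0 (F : numDomainType) n (M : 'M[F]_n) :
  (forall w v, (w - v) * bil M (powers n w) (powers n v) = 0) -> M = 0.
Proof.
move=> M0.
have Mv v : M *m powers n v = 0.
  by apply: (@powers_eq0 _ _ _ v) => w; rewrite mulmxA M0.
apply/row_matrixP => i; rewrite linear0; apply: trmx_inj; rewrite trmx0.
apply: (@powers_eq0 _ _ _ 0) => w.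
by rewrite -trmx_mul -row_mul Mv linear0 trmx0 mxE mulr0.
Qed.

(** On an isotropic vector of [A], the forms [A + B] and [A - B] take opposite
    values, hence both vanish; a semidefinite matrix kills its isotropic
    vectors, so both matrices kill [u]. *)
Lemma psd_line_ker (R : realType) n (A B : 'M[R]_n) (u : 'cV[R]_n) :
  psd (A - B) -> psd (A + B) -> bil A u u = 0 -> B *m u = 0.
Proof.
have psd_ker (M : 'M[R]_n) : psd M -> bil M u u = 0 -> M *m u = 0.
  move=> [Msym M_ge0] Mu0.
  have Mvu v : bil M v u = 0.
    set b := bil M v u; set q := bil M v v.
    have q0 : 0 <= q := M_ge0 v.
    have Muv : bil M u v = b by rewrite -bil_tr Msym.
    have Mt t : 0 <= 2 * t * b + t ^+ 2 * q.
      have -> : 2 * t * b + t ^+ 2 * q = bil M (u + t *: v) (u + t *: v).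
        by rewrite !(bilDl, bilDr, bilZl, bilZr) Mu0 Muv -/b -/q; ring.
      exact: M_ge0.
    (* The minimum over t is at - b / q; the shift by 1 covers q = 0. *)
    have := Mt (- b / (q + 1)).
    have -> : 2 * (- b / (q + 1)) * b + (- b / (q + 1)) ^+ 2 * q =
       - ((b / (q + 1)) ^+ 2 * (q + 2)) by field; apply/eqP; lra.
    rewrite oppr_ge0 => ble; have /eqP : (b / (q + 1)) ^+ 2 * (q + 2) = 0.
      apply/eqP; rewrite eq_le ble mulr_ge0 ?sqr_ge0 //; lra.
    rewrite mulf_eq0 expf_eq0 /= mulf_eq0 invr_eq0 => /orP[/orP[/eqP//|]|] /eqP;
      lra.
  apply/colP => k; have := Mvu (delta_mx k 0).
  by rewrite /bil trmx_delta -mulmxA -rowE mxE => ->; rewrite mxE.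
move=> psdB psdD Au0.
have qB : bil B u u = 0.
  have := psdB.2 u; have := psdD.2 u.
  rewrite -!/(bil _ u u) !(bilD, bilN) Au0 => *; lra.
have := psd_ker _ psdB; have := psd_ker _ psdD.
rewrite !(bilD, bilN) Au0 qB subrr addr0 mulmxBl mulmxDl.
move=> /(_ erefl) AB /(_ erefl)/eqP; rewrite subr_eq0 => /eqP AeqB.
by move: AB; rewrite AeqB -mulr2n -scaler_nat => /eqP;
  rewrite scaler_eq0 pnatr_eq0 => /eqP.
Qed.

(** * The Hermite matrix of [p - z] *)

Definition hermite {R : realType} n (p : {poly R}) (z : R[i]) : 'M[R]_n :=
  -1 *: pencil n p (complex.Re z) (complex.Im z).

Definition posdef {R : realType} {n} (A : 'M[R]_n) : Prop :=
  forall u : 'cV[R]_n, u != 0 -> 0 < bil A u u.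

Section Hermite.
Variables (R : realType) (n : nat) (p : {poly R}).
Hypothesis size_p : size p = n.+1.
Implicit Types (f g h : {poly R}) (u : 'cV[R]_n) (z d : R[i]).

Let size_qx : (size (qx p) <= n.+1)%N.
Proof. by rewrite -size_p size_poly. Qed.

Let size_qy : (size (qy p) <= n.+1)%N.
Proof. by rewrite -size_p size_poly. Qed.

Let size_qz : (size (qz R) <= n.+1)%N.
Proof. by rewrite size_poly1. Qed.

Lemma bil_bezoutian g h (s t : R) :
    (size g <= n.+1)%N -> (size h <= n.+1)%N ->
  (s - t) * bil (bezoutian n g h) (powers n s) (powers n t) =
  g.[s] * h.[t] - g.[t] * h.[s].
Proof. by rewrite bil_powers; exact: bezoutianP. Qed.

(** Bezoutians are alternating and bilinear, and the constants have a zero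
    Bezoutian; so the pencil is the Bezoutian of [qx - x] and [qy - y]. *)
Lemma hermite_powers z (s t : R) :
  let f w := ceval p (0 +i* w) - z in
  (s - t) * bil (hermite n p z) (powers n s) (powers n t) =
  complex.Re (f t) * complex.Im (f s) - complex.Re (f s) * complex.Im (f t).
Proof.
case: z => x y; rewrite /= !ceval_imag /= /hermite /pencil.
rewrite bilZ !(bilD, bilN, bilZ) /=.
have -> : forall a b c : R, (s - t) * (-1 * (a + x * b - y * c)) =
   - ((s - t) * a + x * ((s - t) * b) - y * ((s - t) * c)) by move=> *; ring.
by rewrite !bil_bezoutian // !hornerC; ring.
Qed.

Lemma hermite_sym z : (hermite n p z)^T = hermite n p z.
Proof.
apply/eqP; rewrite -subr_eq0; apply/eqP; apply: bil_powers_eq0 => s t.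
rewrite bilD bilN bil_tr mulrBr (hermite_powers z s t) /=.
by rewrite -(opprB t s) mulNr (hermite_powers z t s) /=; ring.
Qed.

Lemma hermiteD z d : hermite n p (z + d) = hermite n p z +
  (- complex.Re d *: bezoutian n (qy p) (qz R) +
   complex.Im d *: bezoutian n (qx p) (qz R)).
Proof.
rewrite /hermite /pencil; case: z d => [x y] [a b] /=.
by apply/matrixP => k l; rewrite !mxE; ring.
Qed.

Lemma bil_hermiteD z d u : bil (hermite n p (z + d)) u u =
  bil (hermite n p z) u u +
  (- (complex.Re d * bil (bezoutian n (qy p) (qz R)) u u) +
   complex.Im d * bil (bezoutian n (qx p) (qz R)) u u).
Proof. by rewrite hermiteD bilD; congr (_ + _); rewrite bilD !bilZ mulNr. Qed.

(** The Hankel matrix of the coefficients of [f]: both sides satisfy the same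
    telescoping identity for [f(s) - f(t)]. *)
Lemma bezoutian1 f : (size f <= n.+1)%N ->
  bezoutian n f (qz R) = \matrix_(k, l) f`_(k + l).+1.
Proof.
move=> sf; apply/eqP; rewrite -subr_eq0; apply/eqP.
apply: bil_powers_eq0 => s t.
rewrite bilD bilN mulrBr bil_bezoutian // !hornerC !mulr1.
apply/eqP; rewrite subr_eq0; apply/eqP; rewrite bil_powers.
(* Multiplying by s - t turns the (k, l) term into A k.+1 l - A k l.+1; the
   two double sums are the one over the square of side n.+1 without its first
   row, resp. column, because A vanishes beyond the antidiagonal. *)
pose A k l := f`_(k + l) * s ^+ k * t ^+ l.
have A0 k l : (n < k + l)%N -> A k l = 0.
  by move=> kl; rewrite /A nth_default ?mul0r // (leq_trans sf).
have At : \sum_(k < n.+1) \sum_(l < n.+1) A k l =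
    f.[t] + \sum_(k < n) \sum_(l < n) A k.+1 l.
  rewrite big_ord_recl; congr (_ + _).
    rewrite (horner_coef_wide _ sf); apply: eq_bigr => l _.
    by rewrite /A add0n expr0 mulr1.
  apply: eq_bigr => k _; rewrite big_ord_recr /= [A _ n]A0 ?addr0 //.
  by rewrite addSn ltnS leq_addl.
have As : \sum_(k < n.+1) \sum_(l < n.+1) A k l =
    f.[s] + \sum_(k < n) \sum_(l < n) A k l.+1.
  rewrite exchange_big big_ord_recl exchange_big /=; congr (_ + _).
    rewrite (horner_coef_wide _ sf); apply: eq_bigr => k _.
    by rewrite /A addn0 expr0 mulr1.
  rewrite big_ord_recr /= [X in _ + X]big1 ?addr0 // => l _.
  by rewrite A0 // addnS ltnS leq_addr.
have -> : f.[s] - f.[t] = \sum_(k < n) \sum_(l < n) A k.+1 l -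
    \sum_(k < n) \sum_(l < n) A k l.+1.
  by move: At; rewrite As; lra.
rewrite -sumrB mulr_sumr; apply: eq_bigr => k _.
rewrite -sumrB mulr_sumr; apply: eq_bigr => l _.
by rewrite mxE /A addSn addnS !exprS; ring.
Qed.

(** The Hankel matrix vanishes below its antidiagonal, on which it is the
    leading coefficient of [f]: the entries of a kernel vector vanish one after
    the other, the entry [l] by the row [n - 1 - l]. *)
Lemma bezoutian1_inj f u : size f = n.+1 ->
  bezoutian n f (qz R) *m u = 0 -> u = 0.
Proof.
move=> sf; rewrite bezoutian1 ?sf // => fu0.
have u0 m : (m <= n)%N -> forall l : 'I_n, (l < m)%N -> u l 0 = 0.
  elim: m => // m IH mn l; rewrite ltnS leq_eqVlt => /orP[/eqP lm|]; last first.
    by apply: IH; exact: ltnW.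
  have := congr1 (fun v : 'cV_n => v (rev_ord l) 0) fu0.
  rewrite !mxE (bigD1 l) //= big1 ?addr0 => [|i il]; rewrite !mxE /=.
    rewrite -addSn subnSK // subnK ?(ltnW (ltn_ord l)) // => /eqP.
    have -> : f`_n = lead_coef f by rewrite lead_coefE sf.
    by rewrite mulf_eq0 lead_coef_eq0 -size_poly_eq0 sf => /eqP.
  have [i_lt|i_gt|/val_inj i_eq] := ltngtP i l; last by rewrite i_eq eqxx in il.
    by rewrite (IH (ltnW mn)) ?mulr0 // -lm.
  by rewrite nth_default ?mul0r // sf; move: (ltn_ord l); lia.
by apply/colP => l; rewrite mxE (u0 n).
Qed.

Lemma normc_real (a : R) : `|a%:C| = `|a|%:C :> R[i].
Proof. by rewrite normc_def /= expr0n addr0 sqrtr_sqr. Qed.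

Lemma normc_imag (a : R) : `|0 +i* a| = `|a|%:C :> R[i].
Proof. by rewrite normc_def /= expr0n add0r sqrtr_sqr. Qed.

(** A kernel vector of [hermite n p z] would be killed by both the coefficients
    of [x] and [y] in the pencil, one of which is injective because [qx] or
    [qy], according to the parity of [n], has degree [n]. *)
Lemma psd_ball_posdef z (e : R) : 0 < e ->
    (forall d, `|d| < e%:C -> psd (hermite n p (z + d))) ->
  posdef (hermite n p z).
Proof.
move=> e_gt0 psd_e u u_neq0.
have e2 : `|e / 2| < e by rewrite gtr0_norm; lra.
have [_] : psd (hermite n p z).
  by rewrite -[z]addr0; apply: psd_e; rewrite normr0 ltcR.
move=> /(_ u); rewrite -/(bil _ u u) le_eqVlt => /orP[/eqP/esym u0|//].
have qy0 : bezoutian n (qy p) (qz R) *m u = 0.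
  have := @psd_line_ker _ _ (hermite n p z)
    (- (e / 2) *: bezoutian n (qy p) (qz R)) u _ _ u0.
  rewrite -scalemxAl => H.
  have /eqP : - (e / 2) *: (bezoutian n (qy p) (qz R) *m u) = 0.
    apply: H.
      have := psd_e (- (e / 2))%:C; rewrite normc_real normrN ltcR => /(_ e2).
      by rewrite hermiteD /= scale0r addr0 !scaleNr opprK.
    have := psd_e (e / 2)%:C; rewrite normc_real ltcR => /(_ e2).
    by rewrite hermiteD /= scale0r addr0.
  by rewrite scaler_eq0 => /orP[/eqP e0|/eqP//]; exfalso; lra.
have qx0 : bezoutian n (qx p) (qz R) *m u = 0.
  have := @psd_line_ker _ _ (hermite n p z)
    ((e / 2) *: bezoutian n (qx p) (qz R)) u _ _ u0.
  rewrite -scalemxAl => H.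
  have /eqP : (e / 2) *: (bezoutian n (qx p) (qz R) *m u) = 0.
    apply: H.
      have := psd_e (0 +i* (- (e / 2))); rewrite normc_imag normrN ltcR => /(_ e2).
      by rewrite hermiteD /= oppr0 scale0r add0r !scaleNr.
    have := psd_e (0 +i* (e / 2)); rewrite normc_imag ltcR => /(_ e2).
    by rewrite hermiteD /= oppr0 scale0r add0r.
  by rewrite scaler_eq0 => /orP[/eqP e0|/eqP//]; exfalso; lra.
have pn : p`_n != 0.
  have -> : p`_n = lead_coef p by rewrite lead_coefE size_p.
  by rewrite lead_coef_eq0 -size_poly_eq0 size_p.
suff u00 : u = 0 by rewrite u00 eqxx in u_neq0.
(* The coefficient of degree n of p is, up to sign, that of qy or of qx. *)
case n_odd: (odd n).
  apply: bezoutian1_inj qy0; rewrite /qy size_p; apply: size_poly_eq.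
  by rewrite n_odd mulf_neq0 // expf_neq0 // oppr_eq0 oner_eq0.
apply: bezoutian1_inj qx0; rewrite /qx size_p; apply: size_poly_eq.
by rewrite n_odd mulf_neq0 // expf_neq0 // oppr_eq0 oner_eq0.
Qed.

(** By uniqueness of the generating function, a decomposition of it into squares
    of polynomials is a Gram decomposition of the matrix. *)
Lemma psd_hermite_squares z (s : seq {poly R}) :
    (forall a, a \in s -> (size a <= n)%N) ->
    (forall w v, (w - v) * bil (hermite n p z) (powers n w) (powers n v) =
                 (w - v) * \sum_(a <- s) a.[w] * a.[v]) ->
  psd (hermite n p z).
Proof.
move=> size_s Hs; split; first exact: hermite_sym.
pose c (a : {poly R}) : 'cV[R]_n := \col_k a`_k.
have cE (a : {poly R}) u v : bil (c a *m (c a)^T) u v =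
    ((c a)^T *m u) 0 0 * ((c a)^T *m v) 0 0.
  rewrite /bil mulmxA -mulmxA [LHS]mxE big_ord1; congr (_ * _).
  by rewrite -[in RHS](trmxK (_ *m u)) trmx_mul trmxK [RHS]mxE.
have bil_sum u v : bil (\sum_(a <- s) c a *m (c a)^T) u v =
    \sum_(a <- s) bil (c a *m (c a)^T) u v.
  rewrite /bil mulmx_sumr mulmx_suml summxE.
  by apply: eq_bigr.
have -> : hermite n p z = \sum_(a <- s) c a *m (c a)^T.
  apply/eqP; rewrite -subr_eq0; apply/eqP; apply: bil_powers_eq0 => w v.
  rewrite bilD bilN mulrBr Hs bil_sum -mulrBr -sumrB big_seq big1 ?mulr0 // => a.
  move=> /size_s sa; rewrite cE; apply/eqP; rewrite subr_eq0; apply/eqP.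
  congr (_ * _); rewrite mxE (horner_coef_wide _ sa);
  by apply: eq_bigr => k _; rewrite !mxE.
move=> u; rewrite -/(bil _ u u) bil_sum; apply: sumr_ge0 => a _.
by rewrite cE -expr2 sqr_ge0.
Qed.

End Hermite.


(** * Roots in the left half-plane make the Hermite matrix semidefinite *)

(** Induction on the roots.  If [g + jh] is multiplied by [jw - (x + jy)], the
    kernel [K(w, v) = g(v) h(w) - g(w) h(v)] becomes
    [((w - y) (v - y) + x^2) K(w, v) - x (w - v) (g(w) g(v) + h(w) h(v))]:
    each square is replaced by two, and the two new ones have the weight
    [- x >= 0]. *)
Lemma left_roots_squares (R : rcfType) (c : R[i]) (rs : seq R[i]) :
    (forall r, r \in rs -> complex.Re r <= 0) ->
  exists (g h : {poly R}) (s : seq {poly R}),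
    [/\ (size g <= (size rs).+1)%N /\ (size h <= (size rs).+1)%N,
        forall a, a \in s -> (size a <= size rs)%N,
        forall w : R, c * \prod_(r <- rs) ((0 +i* w) - r) = g.[w] +i* h.[w] &
        forall w v, g.[v] * h.[w] - g.[w] * h.[v] =
          (w - v) * \sum_(a <- s) a.[w] * a.[v]].
Proof.
elim: rs => [|[x y] rs IH] rs_le0.
  case: c => c d; exists c%:P, d%:P, [::]; split=> //=.
  - by rewrite !size_polyC; split; case: (_ != 0).
  - by move=> w; rewrite big_nil mulr1 !hornerC.
  - by move=> w v; rewrite big_nil !hornerC; ring.
have [|g [h [s [[sg sh] ss gh K]]]] := IH.
  by move=> r r_in; apply: rs_le0; rewrite inE r_in orbT.
have x_le0 : x <= 0 := rs_le0 _ (mem_head _ _).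
pose b := Num.sqrt (- x).
have bb : b ^+ 2 = - x by rewrite sqr_sqrtr ?oppr_ge0.
have size_lin (q : {poly R}) m : (size q <= m)%N ->
  (size (('X - y%:P) * q)%R <= m.+1)%N.
  move=> sq; apply: leq_trans (size_polyMleq _ _) _.
  by rewrite size_XsubC.
have size_scale (q : {poly R}) m a : (size q <= m)%N -> (size (a *: q)%R <= m.+1)%N.
  by move=> sq; rewrite (leq_trans (size_scale_leq _ _)) // (leq_trans sq).
exists (- x *: g - ('X - y%:P) * h), (- x *: h + ('X - y%:P) * g),
  (b *: g :: b *: h ::
   [seq ('X - y%:P) * a | a <- s] ++ [seq x *: a | a <- s]); split.
- split; rewrite (leq_trans (size_polyD _ _)) // geq_max ?size_polyN;
  by rewrite size_scale ?size_lin.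
- move=> a; rewrite !inE mem_cat => /or4P[/eqP->|/eqP->|/mapP|/mapP].
  + by rewrite (leq_trans (size_scale_leq _ _)).
  + by rewrite (leq_trans (size_scale_leq _ _)).
  + by case=> a' /ss sa ->; exact: size_lin.
  + by case=> a' /ss sa ->; exact: size_scale.
- move=> w; rewrite big_cons mulrCA gh !hornerE /=.
  by apply/eqP; rewrite eq_complex /=; apply/andP; split; apply/eqP; ring.
- move=> w v; rewrite !big_cons big_cat !big_map /=.
  have sum_mul (q : {poly R} -> {poly R}) (d : R -> R) :
      (forall a t, (q a).[t] = d t * a.[t]) ->
    \sum_(a <- s) (q a).[w] * (q a).[v] = d w * d v * \sum_(a <- s) a.[w] * a.[v].
    by move=> qd; rewrite mulr_sumr; apply: eq_bigr => a _; rewrite !qd mulrACA.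
  rewrite (sum_mul ( *%R ('X - y%:P)) (fun t => t - y)); last first.
    by move=> a t; rewrite !hornerE.
  rewrite (sum_mul ( *:%R x) (fun=> x)); last by move=> a t; rewrite hornerZ.
  rewrite !hornerE.
  transitivity ((w - v) * - x * (g.[w] * g.[v] + h.[w] * h.[v]) +
     ((w - y) * (v - y) + x ^+ 2) * (g.[v] * h.[w] - g.[w] * h.[v])).
    by ring.
  by rewrite K -bb /=; ring.
Qed.

Section Roots.
Variables (R : realType) (n : nat) (p : {poly R}).
Hypotheses (size_p : size p = n.+1) (n_gt0 : (0 < n)%N).
Implicit Types (z s r : R[i]).

Lemma ceval_factor z : exists2 rs : seq R[i], size rs = n &
  forall s, ceval p s - z = (lead_coef p)%:C * \prod_(r <- rs) (s - r).
Proof.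
pose P : {poly R[i]} := map_poly (real_complex R) p - z%:P.
have size_zP : (size (- z%:P : {poly R[i]}) < size (map_poly (real_complex R) p))%N.
  by rewrite size_polyN size_map_poly size_p (leq_ltn_trans (size_polyC_leq1 _)).
have lead_P : lead_coef P = (lead_coef p)%:C.
  by rewrite lead_coefDl // lead_coef_map.
have [rs Prs] := closed_field_poly_normal P; exists rs; last first.
  move=> s; have := congr1 (horner^~ s) Prs.
  rewrite /P hornerD hornerN hornerC -/P => ->; rewrite hornerZ lead_P.
  by rewrite horner_prod; under eq_bigr do rewrite hornerXsubC.
have := congr1 (fun Q : {poly _} => size Q) Prs.
rewrite size_polyDl // size_map_poly size_p size_scale ?size_prod_XsubC.
  by case.
by rewrite lead_P fmorph_eq0 lead_coef_eq0 -size_poly_eq0 size_p.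
Qed.

Lemma lead_coef_gt0 : 0 < `|lead_coef p|.
Proof. by rewrite normr_gt0 lead_coef_eq0 -size_poly_eq0 size_p. Qed.

Lemma ceval_root {z} {rs : seq R[i]} {r} :
    (forall s, ceval p s - z = (lead_coef p)%:C * \prod_(r <- rs) (s - r)) ->
  r \in rs -> ceval p r = z.
Proof.
move=> prs r_rs; apply/eqP; rewrite -subr_eq0 prs (big_rem r) //=.
by rewrite subrr mul0r mulr0.
Qed.

Lemma hermite_psd z :
  (forall s, ceval p s = z -> complex.Re s <= 0) -> psd (hermite n p z).
Proof.
move=> z_le0; have [rs size_rs prs] := ceval_factor z.
have [|g [h [S [[sg sh] sS gh K]]]] := @left_roots_squares _ (lead_coef p)%:C rs.
  by move=> r /(ceval_root prs); exact: z_le0.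
apply: (@psd_hermite_squares _ _ _ size_p _ S) => [a|w v].
  by rewrite -size_rs; exact: sS.
by rewrite hermite_powers // !prs !gh /= K.
Qed.

(** [ceval p s - z] is the leading coefficient times the product of the
    [s - r]; the lower bound is uniform in [s] because it only involves the
    distances from the roots to the imaginary axis. *)
Lemma ceval_away z (E : R[i] -> Prop) :
    (forall s r, E s -> ceval p r = z ->
       complex.Re r != 0 /\ `|complex.Re r|%:C <= `|s - r|) ->
  exists2 e : R, 0 < e & forall s, E s -> e%:C <= `|ceval p s - z|.
Proof.
move=> Er; have [rs size_rs prs] := ceval_factor z.
have [[s0 Es0]|noE] := pselect (exists s, E s); last first.
  by exists 1 => // s Es; case: noE; exists s.
exists (`|lead_coef p| * \prod_(r <- rs) `|complex.Re r|).
  rewrite mulr_gt0 ?lead_coef_gt0 // big_seq prodr_gt0 // => r r_rs.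
  by rewrite normr_gt0; have [] := Er _ _ Es0 (ceval_root prs r_rs).
move=> s Es; rewrite prs normrM normc_real rmorphM /=.
rewrite ler_pM2l ?ltcR ?lead_coef_gt0 // rmorph_prod normr_prod !big_seq.
apply: ler_prod => r r_rs; rewrite lecR normr_ge0.
by have [_] := Er _ _ Es (ceval_root prs r_rs).
Qed.

(** Unlike that of [ceval_away], this bound does not depend on [z], so it
    survives when [z] moves to a limit point. *)
Lemma ceval_far z s : 0 <= complex.Re s ->
    (forall r, ceval p r = z -> complex.Re r < 0) ->
  (`|lead_coef p| * complex.Re s ^+ n)%:C <= `|ceval p s - z|.
Proof.
move=> s_ge0 z_lt0; have [rs size_rs prs] := ceval_factor z.
rewrite prs normrM normc_real rmorphM /= ler_pM2l ?ltcR ?lead_coef_gt0 //.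
rewrite -size_rs -[size rs]count_predT -iter_mulr_1 -big_const_seq.
rewrite rmorph_prod normr_prod !big_seq.
apply: ler_prod => r /(ceval_root prs)/z_lt0 r_lt0; rewrite lecR s_ge0 /=.
apply: le_trans (normc_ge_Re _); rewrite lecR.
case: s r {s_ge0} r_lt0 (s_ge0) => [a b] [c d] /= c_lt0 a_ge0.
by rewrite ger0_norm; lra.
Qed.

End Roots.

(** * A definite Hermite matrix constrains the roots *)

Section RealPoly.
Variables (R : realType).

Lemma horner_conj (q : {poly R}) (t : R[i]) :
  (map_poly (real_complex R) q).[conjc t] = conjc (map_poly (real_complex R) q).[t].
Proof.
rewrite -horner_map -map_poly_comp; congr horner.
by apply: eq_map_poly => a /=; rewrite oppr0.
Qed.

Lemma bil_map n (M : 'M[R]_n) u v :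
  bil (map_mx (real_complex R) M) (map_mx (real_complex R) u)
    (map_mx (real_complex R) v) = (bil M u v)%:C.
Proof. by rewrite /bil map_trmx -!map_mxM mxE. Qed.

Lemma powers_map n (t : R) :
  powers n t%:C = map_mx (real_complex R) (powers n t).
Proof. by apply/colP => k; rewrite !mxE rmorphXn. Qed.

End RealPoly.

Section Complexified.
Variables (R : realType) (n : nat) (p : {poly R}).
Hypothesis size_p : size p = n.+1.
Implicit Types (z s t : R[i]).

Let X z : {poly R} := qx p - (complex.Re z)%:P.
Let Y z : {poly R} := qy p - (complex.Im z)%:P.
Local Notation "q %:PC" := (map_poly (real_complex R) q) (at level 2).

Lemma ceval_XY z t : ceval p ('i * t) - z = (X z)%:PC.[t] + 'i * (Y z)%:PC.[t].
Proof.
pose P := map_poly (real_complex R) p \Po ('i *: 'X) - z%:P -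
   ((X z)%:PC + 'i *: (Y z)%:PC).
have PE s : P.[s] = ceval p ('i * s) - z - ((X z)%:PC.[s] + 'i * (Y z)%:PC.[s]).
  by rewrite /P !(hornerD, hornerN, hornerC, hornerZ) horner_comp hornerZ hornerX.
apply/eqP; rewrite -subr_eq0 -PE.
suff -> : P = 0 by rewrite horner0.
apply: poly_nat_eq0 => m; rewrite PE {PE P} -(rmorph_nat (real_complex R) m).
rewrite !horner_map /X /Y !hornerD !hornerN !hornerC.
have -> : 'i * (m%:R)%:C = 0 +i* m%:R :> R[i] by simpc.
rewrite ceval_imag; case: z => x y.
by apply/eqP; rewrite eq_complex /=; apply/andP; split; apply/eqP; ring.
Qed.

(** Both sides are polynomials in [s] and in [t], and they agree on natural
    numbers by the real identity.  One variable is freed at a time, the second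
    one by the antisymmetry of the difference. *)
Lemma hermite_powersC z s t :
  (s - t) * bil (map_mx (real_complex R) (hermite n p z))
     (powers n s) (powers n t) =
  (X z)%:PC.[t] * (Y z)%:PC.[s] - (X z)%:PC.[s] * (Y z)%:PC.[t].
Proof.
set H := map_mx _ _.
have H_sym : H^T = H by rewrite /H map_trmx hermite_sym.
pose Q (t : R[i]) : {poly R[i]} :=
  ('X - t%:P) * \sum_k (H *m powers n t) k 0 *: 'X^k -
  ((X z)%:PC.[t] *: (Y z)%:PC - (Y z)%:PC.[t] *: (X z)%:PC).
have QE u v : (Q v).[u] = (u - v) * bil H (powers n u) (powers n v) -
    ((X z)%:PC.[v] * (Y z)%:PC.[u] - (X z)%:PC.[u] * (Y z)%:PC.[v]).
  rewrite /Q !(hornerD, hornerN, hornerM, hornerZ) hornerX hornerC.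
  by rewrite -powersE mulmxA -/(bil _ _ _); ring.
have Qtr u v : (Q v).[u] = - (Q u).[v].
  by rewrite !QE -[bil H (powers n v) _]bil_tr H_sym; ring.
suff Q0 : forall v, Q v = 0.
  by apply/eqP; rewrite -subr_eq0 -QE Q0 horner0.
have Qnat (m : nat) : Q m%:R = 0.
  apply: poly_nat_eq0 => k; rewrite QE.
  rewrite -(rmorph_nat (real_complex R) m) -(rmorph_nat (real_complex R) k).
  rewrite !powers_map bil_map !horner_map -rmorphB -!rmorphM -!rmorphB /=.
  rewrite hermite_powers //= !ceval_imag; case: (z) => x y /=.
  by rewrite /X /Y !hornerD !hornerN !hornerC /= subrr.
by move=> v; apply: poly_nat_eq0 => m; rewrite Qtr Qnat horner0 oppr0.
Qed.

(** With [s = j t], the identity at [conj t] and [t] reads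
    [Re s * q = - |Y(t)|^2], where [q] is the value of the Hermitian form on
    the powers of [t], i.e. the sum of the values of the real form on their
    real and imaginary parts. *)
Lemma posdef_roots z s : (0 < n)%N -> posdef (hermite n p z) ->
  ceval p s = z -> complex.Re s <= 0.
Proof.
move=> n_gt0 H_pos ps; case: s ps => a b ps /=.
pose t : R[i] := b -i* a.
have it : 'i * t = a +i* b by rewrite /t; simpc.
have := ceval_XY z t; rewrite it ps subrr.
pose x : 'cV[R]_n := \col_k complex.Re (t ^+ k).
pose y : 'cV[R]_n := \col_k complex.Im (t ^+ k).
have tE : powers n t = map_mx (real_complex R) x + 'i *: map_mx (real_complex R) y.
  by apply/colP => k; rewrite !mxE -complexE.
have tJE : powers n (conjc t) =
    map_mx (real_complex R) x - 'i *: map_mx (real_complex R) y.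
  apply/colP => k; rewrite !mxE -rmorphXn /=; case: (t ^+ k) => c d /=.
  by simpc.
have x_neq0 : x != 0.
  apply/eqP => /colP/(_ (Ordinal n_gt0)); rewrite !mxE expr0 /= => /eqP.
  by rewrite oner_eq0.
have := hermite_powersC z (conjc t) t.
rewrite {1}tE {1}tJE -scaleNr !(bilDl, bilDr, bilZl, bilZr) !bil_map.
have -> : bil (hermite n p z) x y = bil (hermite n p z) y x.
  by rewrite -bil_tr hermite_sym.
have := H_pos _ x_neq0; have : 0 <= bil (hermite n p z) y y.
  have [->|/H_pos/ltW//] := eqVneq y 0.
  by rewrite /bil mulmx0 mxE.
set q1 := bil _ x x; set q2 := bil _ y y; set q3 := bil _ y x.
move=> q2_ge0 q1_gt0.
rewrite !horner_conj.
move: ((X z)%:PC.[t]) ((Y z)%:PC.[t]) => [c d] [e f].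
rewrite /t /=; simpc => -[_ eq_q] -[cf de].
have {}cf : c = f by lra.
have {}de : d = - e by lra.
move: eq_q; rewrite cf de => eq_q.
rewrite leNgt; apply/negP => a_gt0.
have : 0 < (a + a) * (q1 + q2) by apply: mulr_gt0; lra.
rewrite eq_q ltNge => /negP; apply.
by have := sqr_ge0 e; have := sqr_ge0 f; rewrite !expr2 => *; lra.
Qed.

(** If [z = p(jw)] then the right-hand side of the identity vanishes for
    [t = w], so the powers of [w] are in the kernel. *)
Lemma posdef_off_curve z (w : R) : (0 < n)%N -> posdef (hermite n p z) ->
  ceval p (0 +i* w) != z.
Proof.
move=> n_gt0 H_pos; apply/eqP => pw.
have Hw0 : hermite n p z *m powers n w = 0.
  apply: (@powers_eq0 _ _ _ w) => s; rewrite mulmxA -/(bil _ _ _).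
  by rewrite hermite_powers // pw subrr /= mul0r mulr0 subrr.
have w_neq0 : powers n w != 0.
  apply/eqP => /colP/(_ (Ordinal n_gt0)); rewrite !mxE expr0 => /eqP.
  by rewrite oner_eq0.
by have := H_pos _ w_neq0; rewrite /bil -mulmxA Hw0 mulmx0 mxE ltxx.
Qed.

End Complexified.

(** * Topology of the complex plane *)

Lemma nbhs_complexP {R : realType} (z : R[i]^o) (B : set R[i]^o) :
  nbhs z B <-> exists2 e : R, 0 < e & forall y, `|z - y| < e%:C -> B y.
Proof.
split=> [/nbhs_ballP[[e e'] /=]|[e e_gt0 eB]].
  by rewrite ltcE /= => /andP[/eqP-> e_gt0] eB; exists e => //.
by apply/nbhs_ballP; exists e%:C; rewrite /= ?ltcR.
Qed.

Lemma closure_complexP {R : realType} (A : set R[i]^o) (z : R[i]^o) :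
  closure A z <->
  forall e : R, 0 < e -> exists2 y, A y & `|z - y| < e%:C.
Proof.
split=> [cA e e_gt0|Ae B /nbhs_complexP[e e_gt0 eB]].
  have [|y [Ay ye]] := cA [set y | `|z - y| < e%:C].
    by apply/nbhs_complexP; exists e.
  by exists y.
by have [y Ay /eB By] := Ae e e_gt0; exists y.
Qed.

Lemma normc_fin {R : realType} (z : R[i]) : exists2 m : R, 0 <= m & `|z| = m%:C.
Proof. by rewrite normc_def; eexists; last reflexivity; exact: sqrtr_ge0. Qed.

Lemma scale_continuous {R : realType} (z : R[i]) :
  continuous (fun t : R => t%:C * z : R[i]^o).
Proof.
move=> t B /nbhs_complexP[e e_gt0 eB].
have [m m_ge0 zm] := normc_fin z.
apply/nbhs_ballP; exists (e / (m + 1)); first by rewrite /= divr_gt0 //; lra.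
move=> t'; rewrite -ball_normE /= => tt'; apply: eB.
rewrite -mulrBl -rmorphB normrM normc_real zm -rmorphM ltcR.
rewrite ltr_pdivlMr in tt'; last lra.
by apply: le_lt_trans tt'; rewrite ler_wpM2l //; lra.
Qed.

Lemma component_segment {R : realType} (A : set R[i]^o) (z : R[i]) :
    (forall t : R, 0 <= t <= 1 -> A (t%:C * z)) ->
  connected_component A 0 z.
Proof.
move=> Az.
have conn : connected [set (t%:C * z : R[i]^o) | t in `[0, 1]%classic].
  apply: connected_continuous_connected; first exact: segment_connected.
  by apply: continuous_subspaceT; exact: scale_continuous.
apply: (connected_component_max _ _ conn).
- by exists 0 => /=; rewrite ?in_itv /= ?lexx ?ler01 // mul0r.
- by move=> y [t /=]; rewrite in_itv /= => t01 <-; exact: Az.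
- by exists 1 => /=; rewrite ?in_itv /= ?lexx ?ler01 // mul1r.
Qed.

Lemma linear_bound {R : realDomainType} {x y m : R} :
    `|x| <= m -> `|y| <= m ->
  forall a b, - (x * a) + y * b <= m * (`|a| + `|b|).
Proof.
move=> xm ym a b; rewrite mulrDr lerD // (le_trans (ler_norm _)) //.
  by rewrite normrN normrM ler_wpM2r.
by rewrite normrM ler_wpM2r.
Qed.

(** * The component of the origin *)

Section Region.
Variables (R : realType) (n : nat) (p : {poly R}).
Hypotheses (size_p : size p = n.+1) (n_gt0 : (0 < n)%N).
Implicit Types (z d s r : R[i]).

Definition left_roots : set R[i]^o :=
  [set z | forall s, ceval p s = z -> complex.Re s < 0].

Let normc_ge_Re_sub s r (a : R) :
  a <= `|complex.Re s - complex.Re r| -> a%:C <= `|s - r|.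
Proof.
move=> a_le; apply: le_trans (normc_ge_Re _); rewrite lecR.
by case: s r a_le => [? ?] [? ?].
Qed.

(** A root [s] of [p - (z + d)] with [Re s >= 0] has [|p(s) - z| = |d|], which
    is impossible for [d] small. *)
Lemma left_roots_open z : left_roots z ->
  exists2 e : R, 0 < e & forall d, `|d| < e%:C -> left_roots (z + d).
Proof.
move=> z_left.
have [|e e_gt0 e_le] := ceval_away _ _ _ size_p n_gt0 z (fun s => 0 <= complex.Re s).
  move=> s r s_ge0 /z_left r_lt0; split; first by rewrite lt_eqF.
  by apply: normc_ge_Re_sub; rewrite ltr0_norm // ger0_norm; lra.
exists e => // d d_lt s ps; rewrite ltNge; apply/negP => /e_le.
by rewrite ps addrAC subrr add0r => /le_lt_trans/(_ d_lt); rewrite ltxx.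
Qed.

Lemma left_roots_posdef z : left_roots z -> posdef (hermite n p z).
Proof.
move=> /left_roots_open[e e_gt0 e_left]; apply: (psd_ball_posdef _ _ _ _ _ e) => //.
move=> d /e_left d_left; apply: hermite_psd => // s ps.
by apply: ltW; exact: d_left.
Qed.

Lemma left_roots_off_curve z : left_roots z -> (~` frequency_response p) z.
Proof. by move=> z_left [w _ /z_left /=]; rewrite ltxx. Qed.

(** For a root [s] of [p - z] with [Re s > 0], the number [p(s) = z] is at least
    [|p_n| (Re s)^n] away from every point of [left_roots]. *)
Lemma left_roots_closed z : (~` frequency_response p) z ->
  closure left_roots z -> left_roots z.
Proof.
move=> z_off /closure_complexP z_cl s ps; rewrite ltNge; apply/negP => s_ge0.
have s_gt0 : 0 < complex.Re s.
  rewrite lt_neqAle s_ge0 andbT; apply/eqP => s0; apply: z_off.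
  by exists (complex.Im s) => //; rewrite s0; case: (s) ps.
have [|y y_left] := z_cl (`|lead_coef p| * complex.Re s ^+ n).
  by rewrite mulr_gt0 ?exprn_gt0 //; exact: lead_coef_gt0 size_p.
have := ceval_far _ _ _ size_p n_gt0 y s s_ge0 y_left.
by rewrite ps => /le_lt_trans/[apply]; rewrite ltxx.
Qed.

(** A connected set through [0] avoiding the curve meets [left_roots] in a
    subset that is open and closed in it. *)
Lemma component_left_roots : left_roots 0 ->
  connected_component (~` frequency_response p) 0 `<=` left_roots.
Proof.
move=> left0 z [A [A0 A_off A_conn] Az].
suff AS : A `&` left_roots = A by move: Az; rewrite -AS => -[].
apply: A_conn.
- by exists 0.
- exists left_roots => //; rewrite openE => y /left_roots_open[e e_gt0 e_left].
  apply/nbhs_complexP; exists e => // y'; rewrite distrC => /e_left.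
  by rewrite addrC subrK.
- exists (closure left_roots); first exact: closed_closure.
  apply/seteqP; split=> y [Ay]; first by move=> ?; split=> //; exact: subset_closure.
  by move=> /left_roots_closed y_left; split=> //; apply: y_left; exact: A_off.
Qed.

Lemma psd_closed : closure [set z : R[i]^o | psd (hermite n p z)] `<=`
  [set z : R[i]^o | psd (hermite n p z)].
Proof.
move=> z /closure_complexP z_cl; split; first exact: hermite_sym.
move=> u; rewrite -/(bil _ u u) leNgt; apply/negP => u_lt0.
pose a := bil (bezoutian n (qy p) (qz R)) u u.
pose b := bil (bezoutian n (qx p) (qz R)) u u.
have ab_gt0 : 0 < `|a| + `|b| + 1.
  by rewrite ltr_pwDr // addr_ge0.
have [|y [_ /(_ u)]] := z_cl (- bil (hermite n p z) u u / (`|a| + `|b| + 1)).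
  by apply: divr_gt0 => //; rewrite oppr_gt0.
rewrite -/(bil _ u u) -[y](subrK z) addrC opprD addNKr normrN bil_hermiteD -/a -/b => q_ge0.
have [m m_ge0 dm] := normc_fin (y - z).
have re_le : `|complex.Re (y - z)| <= m by rewrite -lecR -dm normc_ge_Re.
have im_le : `|complex.Im (y - z)| <= m.
  by rewrite -lecR -dm -normrN -ReiNIm (le_trans (normc_ge_Re _)) // normrM
    normc_imag normr1 mulr1.
rewrite dm ltcR ltr_pdivlMr //; apply/negP; rewrite -leNgt mulrDr mulr1.
apply: (le_trans _ (le_trans (linear_bound re_le im_le a b) _)).
  by rewrite -subr_ge0 opprK addrC.
by rewrite lerDl.
Qed.

(** On the segment from [0] to [z], the affine matrix is a convex combination of
    a definite and a semidefinite one, hence definite before [z]; there the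
    segment cannot meet the curve. *)
Lemma psd_closure_component z :
    posdef (hermite n p 0) -> psd (hermite n p z) ->
  closure (connected_component (~` frequency_response p) 0) z.
Proof.
move=> pos0 psdz; apply/closure_complexP => e e_gt0.
have [m m_ge0 zm] := normc_fin z.
(* (1 - t) m = t e < e, so t z is within e of z. *)
pose t := m / (m + e).
have tme : t * (m + e) = m by rewrite divfK // gt_eqF //; lra.
have t_ge0 : 0 <= t by apply: divr_ge0; lra.
have t_lt1 : t < 1 by rewrite ltr_pdivrMr; lra.
exists (t%:C * z); last first.
  rewrite -[X in X - _]mul1r -mulrBl normrM zm -[1]/(1%:C) -rmorphB normc_real.
  rewrite -rmorphM ltcR ger0_norm; last lra.
  have -> : (1 - t) * m = t * e by lra.
  by rewrite gtr_pMl.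
apply: component_segment => t' t'01 [w _ /eqP]; apply/negP.
apply: (posdef_off_curve _ _ _ size_p) => // u u_neq0.
have t't : 0 <= t' * t < 1.
  case/andP: t'01 => t'_ge0 t'_le1.
  by rewrite mulr_ge0 //= (le_lt_trans _ t_lt1) // ler_piMl.
rewrite mulrA -rmorphM; move: (t' * t) t't => c /andP[c_ge0 c_lt1].
have -> : hermite n p (c%:C * z) = (1 - c) *: hermite n p 0 + c *: hermite n p z.
  rewrite /hermite /pencil; case: (z) => x y; simpc => /=.
  by apply/matrixP => k l; rewrite !mxE; ring.
rewrite bilD (bilZ _ _ (1 - c)) (bilZ _ _ c) ltr_wpDr //.
  by rewrite mulr_ge0 //; exact: psdz.2.
by rewrite mulr_gt0 ?subr_gt0 // pos0.
Qed.

(** The curve stays away from [0], by the lower bound on the imaginary axis, so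
    the segments from [0] to nearby points avoid it. *)
Lemma component_ball : (~` frequency_response p) 0 ->
  exists2 e : R, 0 < e &
    forall d, `|d| < e%:C -> connected_component (~` frequency_response p) 0 d.
Proof.
move=> off0.
have [|e e_gt0 e_le] := ceval_away _ _ _ size_p n_gt0 0 (fun s => complex.Re s = 0).
  move=> s r s0 pr; split; last by apply: normc_ge_Re_sub; rewrite s0 sub0r normrN.
  apply/eqP => r0; apply: off0; exists (complex.Im r) => //.
  by rewrite -pr -[X in X +i* _]r0; case: (r).
exists e => // d d_lt; apply: component_segment => t t01 [w _ pw].
have := e_le (0 +i* w) erefl; rewrite pw subr0 normrM normc_real => e_le_td.
have : e%:C < e%:C :> R[i]; last by rewrite ltxx.
apply: le_lt_trans d_lt; apply: le_trans e_le_td _.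
by rewrite ler_piMl // lecR ger0_norm; lra.
Qed.

End Region.

(** The curve is a real point [c].  Arbitrarily close to any [z] there is a
    point off the real axis, and the segment from [0] to it misses [c]. *)
Lemma origin_region_const {R : realType} (p : {poly R}) : size p = 1%N ->
  (~` frequency_response p) 0 -> origin_region p = setT.
Proof.
move=> /eqP/size_poly1P[c c_neq0 ->] off0; apply/seteqP; split=> // z _.
have pE w : ceval c%:P w = c%:C by rewrite /ceval map_polyC hornerC.
apply/closure_complexP => e e_gt0.
have [d [d_gt0 d_lt d_neq]] : exists d, [/\ 0 < d, d < e & complex.Im z + d != 0].
  have [z_eq|z_neq] := eqVneq (complex.Im z + e / 2) 0; last first.
    by exists (e / 2); split=> //; lra.
  by exists (e / 3); split; [lra|lra|apply/eqP => ?; lra].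
exists (z + (0 +i* d)); last first.
  by rewrite opprD addNKr normrN normc_imag ltcR gtr0_norm.
apply: component_segment => t _ [w _].
rewrite pE; case: z d_neq => x y /= yd_neq; simpc => -[cE].
have t_neq0 : t != 0 by apply: contraNneq c_neq0 => t0; rewrite cE t0 mul0r.
by move=> /esym/eqP; rewrite mulf_eq0 (negPf t_neq0) (negPf yd_neq).
Qed.

Theorem theorem1 (R : realType) :
  exists eps : R, (eps = 1 \/ eps = -1) /\
    forall (n : nat) (p : {poly R}), size p = n.+1 ->
      (~ frequency_response p 0 /\
       origin_region p =
         [set z | exists x y : R, z = x +i* y /\ psd (eps *: pencil n p x y)])
      <-> stable p.
Proof.
exists (-1); split; first by right.
move=> n p size_p.
have -> : [set z | exists x y : R, z = x +i* y /\ psd (-1 *: pencil n p x y)] =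
    [set z : R[i]^o | psd (hermite n p z)].
  apply/seteqP; split=> [_ [x [y [-> //]]]|[x y] psd_xy].
  by exists x, y.
have [n0|n_gt0] := posnP n.
  rewrite n0 in size_p *.
  have p_off s : ceval p s != 0.
    have /eqP/size_poly1P[c c_neq0 ->] := size_p.
    by rewrite /ceval map_polyC hornerC fmorph_eq0.
  have off0 : (~` frequency_response p) 0.
    by move=> [w _ pw]; move: (p_off (0 +i* w)); rewrite pw eqxx.
  split=> [_ s /eqP|_]; first by rewrite (negPf (p_off s)).
  split=> //; rewrite origin_region_const //; apply/seteqP; split=> // z _.
  split; first by rewrite !flatmx0.
  by move=> u; rewrite -/(bil _ u u) bilE big_ord0.
split=> [[off0 regionE]|p_stable].
- have [e e_gt0 e_comp] := component_ball _ _ _ size_p n_gt0 off0.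
  have pos0 : posdef (hermite n p 0).
    apply: (psd_ball_posdef _ _ _ size_p _ e) => // d /e_comp d_comp; rewrite add0r.
    have : origin_region p d by exact: subset_closure.
    by rewrite regionE.
  move=> s ps; rewrite lt_neqAle (posdef_roots _ _ _ size_p _ _ n_gt0 pos0 ps) andbT.
  apply/eqP => s0; apply: off0; exists (complex.Im s) => //.
  by rewrite -ps -[X in X +i* _]s0; case: (s).
- have left0 : left_roots _ p 0 := p_stable.
  split; first exact: left_roots_off_curve left0.
  apply/seteqP; split=> z.
    move=> z_cl; apply: (psd_closed _ _ _ size_p); apply: closureS z_cl => y.
    move=> /(component_left_roots _ _ _ size_p n_gt0 left0) y_left.
    by apply: (hermite_psd _ _ _ size_p n_gt0) => s /y_left/ltW.
  apply: (psd_closure_component _ _ _ size_p n_gt0).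
  exact: (left_roots_posdef _ _ _ size_p n_gt0).
Qed.
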